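(* Assume $A=[a_1\ \cdots\ a_n]\in\mathbb{R}^{m\times n}$ is a nonzero matrix, and let $B$, $N$, $L$, $\rho_B(A)$, $\rho_N(A)$, $\phi$ be as defined in the context. (a) If $N=\emptyset$ then $L\ne\{0\}$ and $\phi(A)\ge|\rho_B(A)|$. (b) If $B=\emptyset$ then $\phi(\bar A)\ge\rho_N(A)$ for $\bar A=[A\ \ 0]\in\mathbb{R}^{m\times(n+1)}$ (the matrix $A$ with one zero column appended). (c) If $B\ne\emptyset$ and $L=\{0\}$ then $\phi(A)\ge\rho_N(A)$. (d) If $N\ne\emptyset$ and $L\ne\{0\}$ then $$\phi(A)\ge\frac{|\rho_B(A)|\,\rho_N(A)}{\sqrt{\|A\|^2+\rho_N(A)^2}},\qquad\text{where }\|A\|=\max_{i=1,\dots,n}\|a_i\| .$$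
   Context: For vectors, $\|\cdot\|$ is the Euclidean norm; $\langle\cdot,\cdot\rangle$ is the standard inner product. $\Delta_{n-1}=\{x\in\mathbb{R}^n:x\ge0,\ \|x\|_1=1\}$. For $x\ge0$, $S(x)=\{i:x_i>0\}$. Restricted width. For a nonzero matrix $M\in\mathbb{R}^{m\times p}$ and $x\in\mathbb{R}^p$, $x\ge0$, $Mx\ne0$, let $$\phi(M,x)=\sup\left\{\lambda>0:\ \exists\,u,v\in\Delta_{p-1},\ S(u)\subseteq S(x),\ Mu-Mv=\frac{\lambda}{\|Mx\|}Mx\right\},$$ and $\phi(M)=\min\{\phi(M,x):x\ge0,\ Mx\ne0\}$. Canonical partition. For $A=[a_1\ \cdots\ a_n]$ nonzero there is a unique partition $B\cup N=\{1,\dots,n\}$ (disjoint, either part possibly empty) such that both systems ''$A_Bx_B=0,\ x_B>0$'' and ''$A_N^{\mathrm T}y>0,\ A_B^{\mathrm T}y=0$'' are feasible, where $A_B$, $A_N$ are the submatrices of columns indexed by $B$, $N$, and vector inequalities are componentwise strict. Let $L=\operatorname{span}(A_B)$ be the span of the columns of $A_B$ and $L^\perp$ its orthogonal complement in $\mathbb{R}^m$; by convention $L=\{0\}$ and $L^\perp=\mathbb{R}^m$ when $B=\emptyset$. If $L\ne\{0\}$, $\displaystyle\rho_B(A)=\max_{z\in L,\ \|z\|=1}\ \min_{i\in B}\langle a_i,z\rangle$. If $N\ne\emptyset$, $\displaystyle\rho_N(A)=\max_{z\in L^\perp,\ \|z\|=1}\ \min_{i\in N}\langle a_i,z\rangle$.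 *)

(* Defs.v *)
From HB Require Import structures.
From mathcomp Require Import all_boot all_order all_algebra.
From mathcomp Require Import boolp classical_sets reals.

Set Implicit Arguments.
Unset Strict Implicit.
Unset Printing Implicit Defensive.

Import Order.TTheory GRing.Theory Num.Theory.

Local Open Scope classical_set_scope.
Local Open Scope ring_scope.

Section Definitions.

Context {R : realType}.

Definition dotv {n} (x y : 'cV[R]_n) : R := \sum_i x i 0 * y i 0.

Definition enorm {n} (x : 'cV[R]_n) : R := Num.sqrt (dotv x x).

Definition nonneg {n} (x : 'cV[R]_n) : Prop := forall i, 0 <= x i 0.

Definition positive {n} (x : 'cV[R]_n) : Prop := forall i, 0 < x i 0.

Definition simplex {n} : set 'cV[R]_n :=
  [set x | nonneg x /\ \sum_i `|x i 0| = 1].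

Definition supp {n} (x : 'cV[R]_n) : {set 'I_n} := [set i | 0 < x i 0]%SET.

(* The admissible lambda are bounded (by the diameter of the convex hull of the
   columns of M), so [sup] takes its default value only if there are none; the
   supremum is then 0. *)
Definition phi_at {m p} (M : 'M[R]_(m, p)) (x : 'cV[R]_p) : R :=
  sup [set lambda : R | 0 < lambda /\
    exists u v : 'cV[R]_p,
      [/\ simplex u, simplex v, supp u \subset supp x &
          M *m u - M *m v = (lambda / enorm (M *m x)) *: (M *m x)]].

(* min {phi(M, x) : x >= 0, M x != 0}.  For M != 0 this is the infimum of a
   nonempty set of nonnegative reals; it is attained because for each of the
   finitely many supports of x, phi(M, x) is a continuous function of the
   direction of M x, and it can only decrease when the support shrinks. *)
Definition phi {m p} (M : 'M[R]_(m, p)) : R :=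
  inf [set phi_at M x | x in [set x | nonneg x /\ M *m x != 0]].

Definition colsubset {m n} (A : 'M[R]_(m, n)) (J : {set 'I_n}) :
    'M[R]_(m, #|J|) :=
  colsub (fun k : 'I_#|J| => enum_val k) A.

Definition canonical_partition {m n} (A : 'M[R]_(m, n)) (B N : {set 'I_n}) :
    Prop :=
  [/\ (B :|: N = [set: 'I_n])%SET, [disjoint B & N]%B,
      (exists xB : 'cV[R]_#|B|, colsubset A B *m xB = 0 /\ positive xB) &
      (exists y : 'cV[R]_m,
         positive ((colsubset A N)^T *m y) /\ (colsubset A B)^T *m y = 0)].

Definition colspan {m n} (A : 'M[R]_(m, n)) (J : {set 'I_n}) :
    {vspace 'cV[R]_m} :=
  <<[seq col j A | j in J]>>%VS.

Definition orthoc {m} (V : {vspace 'cV[R]_m}) : set 'cV[R]_m :=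
  [set z | forall w, w \in V -> dotv w z = 0].

(* max_{z in V, ||z|| = 1} min_{i in J} <a_i, z>.  For nonempty J the inner
   infimum is over a finite nonempty set; if moreover the unit sphere of the
   subspace V is nonempty, the outer supremum is attained by compactness. *)
Definition maxmin {m n} (A : 'M[R]_(m, n)) (V : set 'cV[R]_m)
    (J : {set 'I_n}) : R :=
  sup [set inf [set dotv (col i A) z | i in [set i | i \in J]] |
       z in [set z | V z /\ enorm z = 1]].

Definition rhoB {m n} (A : 'M[R]_(m, n)) (B : {set 'I_n}) : R :=
  maxmin A [set z | z \in colspan A B] B.

Definition rhoN {m n} (A : 'M[R]_(m, n)) (B N : {set 'I_n}) : R :=
  maxmin A (orthoc (colspan A B)) N.

Definition maxcolnorm {m n} (A : 'M[R]_(m, n)) : R :=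
  \big[Num.max/0]_(i < n) enorm (col i A).

End Definitions.

(* Main.v *)
Require Import Defs.
From HB Require Import structures.
From mathcomp Require Import all_boot all_order all_algebra.
From mathcomp Require Import boolp classical_sets reals.
From mathcomp Require Import ring lra.

Import Order.TTheory GRing.Theory Num.Theory.
Local Open Scope ring_scope.

(* The theorem of the alternative, applied inside L = span(A_B), shows that
   every point of L of norm at most r = |rho_B(A)| is A v for some v in the
   simplex.  Given x, split A x = h + g into the contributions of N and B, and let
   sigma be the mass of x on N.  If |g| <= r sigma, take u = x_N / sigma and let
   A v cancel g; this gives lambda = |A x| / sigma >= rho_N(A).  Otherwise take
   u = s x_N + t x_B with s - t = r / |g|, again cancelling the B-component with A v,
   which gives lambda = s |A x| >= r |A x| / |g|; a unit vector of L^perp almost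
   attaining rho_N(A) bounds |A x| / |g| from below.  In (b) and (c) a zero column
   makes M u itself parallel to M x. *)

(** * Euclidean inner product and norm *)

Section EuclideanVectors.
Context {R : realType} {m : nat}.
Implicit Types (x y z w : 'cV[R]_m) (c : R).

Lemma dotvC x y : dotv x y = dotv y x.
Proof. by apply: eq_bigr => i _; rewrite mulrC. Qed.

Lemma dotvDl x y z : dotv (x + y) z = dotv x z + dotv y z.
Proof. by rewrite -big_split; apply: eq_bigr => i _; rewrite mxE mulrDl. Qed.

Lemma dotvZl c x z : dotv (c *: x) z = c * dotv x z.
Proof. by rewrite /dotv mulr_sumr; apply: eq_bigr => i _; rewrite mxE mulrA. Qed.

Lemma dotvDr x y z : dotv z (x + y) = dotv z x + dotv z y.
Proof. by rewrite ![dotv z _]dotvC dotvDl. Qed.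

Lemma dotvZr c x z : dotv z (c *: x) = c * dotv z x.
Proof. by rewrite ![dotv z _]dotvC dotvZl. Qed.

Lemma dotvBl x y z : dotv (x - y) z = dotv x z - dotv y z.
Proof. by rewrite -[- y]scaleN1r dotvDl dotvZl mulN1r. Qed.

Lemma dot0v z : dotv 0 z = 0.
Proof. by rewrite -(scale0r (0 : 'cV[R]_m)) dotvZl mul0r. Qed.

Lemma dotv_ge0 x : 0 <= dotv x x.
Proof. by apply: sumr_ge0 => i _; rewrite -expr2 sqr_ge0. Qed.

Lemma dotv_gt0 x : x != 0 -> 0 < dotv x x.
Proof.
move=> xn0; rewrite lt_def dotv_ge0 andbT; apply: contraNN xn0.
rewrite psumr_eq0 => [/allP h|i _]; last by rewrite -expr2 sqr_ge0.
apply/eqP/matrixP => i j; rewrite ord1 mxE.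
by have := h i (mem_index_enum i); rewrite -expr2 sqrf_eq0 => /eqP.
Qed.

Lemma enorm_ge0 x : 0 <= enorm x.
Proof. exact: sqrtr_ge0. Qed.

Lemma enorm_gt0 x : x != 0 -> 0 < enorm x.
Proof. by move=> xn0; rewrite sqrtr_gt0 dotv_gt0. Qed.

Lemma enorm_sq x : enorm x ^+ 2 = dotv x x.
Proof. by rewrite sqr_sqrtr // dotv_ge0. Qed.

Lemma enormZ c x : enorm (c *: x) = `|c| * enorm x.
Proof.
by rewrite /enorm dotvZl dotvZr mulrA -expr2 sqrtrM ?sqr_ge0 // sqrtr_sqr.
Qed.

Lemma enorm_normalize x : x != 0 -> enorm ((enorm x)^-1 *: x) = 1.
Proof.
move=> xn0; rewrite enormZ ger0_norm ?invr_ge0 ?enorm_ge0 //.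
by rewrite mulVf // gt_eqF ?enorm_gt0.
Qed.

Lemma cauchy_schwarz x y : `|dotv x y| <= enorm x * enorm y.
Proof.
have [->|yn0] := eqVneq y 0.
  by rewrite dotvC dot0v normr0 mulr_ge0 ?enorm_ge0.
rewrite -(@ler_pXn2r _ 2) ?nnegrE ?mulr_ge0 ?enorm_ge0 //.
rewrite exprMn !enorm_sq real_normK ?num_real //.
(* This square equals [p * (p * s - q ^+ 2)] in the abbreviations introduced below, and [p] is
   positive. *)
have := dotv_ge0 (dotv y y *: x + - dotv x y *: y).
rewrite !(dotvDl, dotvDr, dotvZl, dotvZr) (dotvC y x).
have := dotv_gt0 _ yn0; set p := dotv y y; set q := dotv x y.
move: (dotv x x) => s p0 h.
rewrite -subr_ge0 -(pmulr_rge0 _ p0); apply: le_trans h _.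
rewrite le_eqVlt; apply/orP; left; apply/eqP; ring.
Qed.

Lemma dotv_le x y : dotv x y <= enorm x * enorm y.
Proof. exact: le_trans (ler_norm _) (cauchy_schwarz _ _). Qed.

End EuclideanVectors.

(** * Theorem of the alternative inside a subspace *)

Section Gordan.
Context {R : realType} {m : nat} {I : eqType}.

(** Quantifying over every [e'] up to [e] lets the induction keep the smaller of the thresholds for
    head and tail. *)
Lemma small_perturbation (s : seq I) (f g : I -> R) :
  (forall i, i \in s -> 0 < f i) ->
  exists2 e, 0 < e & forall e', 0 < e' <= e ->
    forall i, i \in s -> 0 < f i + e' * g i.
Proof.
elim: s => [|i s IH] fpos; first by exists 1.
have [|e e0 he] := IH; first by move=> j js; apply: fpos; rewrite inE js orbT.
have fi : 0 < f i by apply: fpos; rewrite mem_head.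
exists (Num.min e (f i / (2 * (1 + `|g i|)))).
  by rewrite lt_min e0 divr_gt0 // mulr_gt0 // ltr_wpDr.
move=> e'; rewrite le_min => /and3P[e'0 e'e e'f] j; rewrite inE => /orP[/eqP->|js].
  have gg : - `|g i| <= g i by rewrite lerNl -normrN ler_norm.
  move: e'f; rewrite ler_pdivlMr; last by rewrite mulr_gt0 // ltr_wpDr.
  by have := normr_ge0 (g i); nra.
by apply: he => //; rewrite e'0.
Qed.

(* Induction on [s]: given [y] for the tail and a vector [a j] with
   [<a j, y> < 0], replace every other vector by its combination with [a j]
   that is orthogonal to [y]. *)
Lemma gordan (W : {vspace 'cV[R]_m}) (s : seq I) (a : I -> 'cV[R]_m) :
  uniq s -> (forall i, i \in s -> a i \in W) ->
  (exists2 y, y \in W & forall i, i \in s -> 0 < dotv (a i) y) \/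
  (exists c : I -> R, [/\ forall i, 0 <= c i, 0 < \sum_(i <- s) c i &
     \sum_(i <- s) c i *: a i = 0]).
Proof.
elim: s a => [|j s IH] a /=; first by left; exists 0 => //; exact: mem0v.
move=> /andP[js us] aW.
have ajW : a j \in W by apply: aW; rewrite mem_head.
have asW i : i \in s -> a i \in W by move=> i_s; apply: aW; rewrite inE i_s orbT.
have neq_j i : i \in s -> (i == j) = false.
  by move=> i_s; apply: contraNF js => /eqP <-.
(* Since [j] is not in [s], the weight at [j] can be reset to [d] without affecting the tail. *)
have extend d (c : I -> R) : 0 <= d -> (forall i, 0 <= c i) ->
    0 < d + \sum_(i <- s) c i -> d *: a j + \sum_(i <- s) c i *: a i = 0 ->
    exists c : I -> R, [/\ forall i, 0 <= c i, 0 < \sum_(i <- j :: s) c i &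
       \sum_(i <- j :: s) c i *: a i = 0].
  move=> d0 c0 dc dca; exists (fun i => if i == j then d else c i); split.
  - by move=> i; case: ifP.
  - rewrite big_cons eqxx (eq_big_seq c) // => i i_s.
    by rewrite neq_j.
  - rewrite big_cons eqxx (eq_big_seq (fun i => c i *: a i)) // => i i_s.
    by rewrite neq_j.
have [aj0|ajn0] := eqVneq (a j) 0.
  right; apply: (extend 1 (fun=> 0)) => //.
  - by rewrite big1 // addr0.
  - by rewrite aj0 scaler0 add0r big1 // => i _; rewrite scale0r.
(* A weak inequality at [j] suffices: a small multiple of the nonzero [a j] makes it strict and
   keeps the others strict. *)
have finish y : y \in W -> (forall i, i \in s -> 0 < dotv (a i) y) ->
    0 <= dotv (a j) y ->
    exists2 y, y \in W & forall i, i \in j :: s -> 0 < dotv (a i) y.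
  move=> yW ys yj.
  have [e e0 he] := small_perturbation s _ (fun i => dotv (a i) (a j)) ys.
  exists (y + e *: a j); first by rewrite memvD // memvZ.
  move=> i; rewrite inE dotvDr dotvZr => /orP[/eqP->|i_s].
    by rewrite ltr_wpDl // mulr_gt0 // dotv_gt0.
  by apply: he => //; rewrite e0 lexx.
have [[y yW ys]|[c [c0 cs ca]]] := IH a us asW; last first.
  by right; apply: (extend 0 c); rewrite ?scale0r ?add0r.
have [yj|yj] := leP 0 (dotv (a j) y); first by left; exact: finish yW ys yj.
pose b i := - dotv (a j) y *: a i + dotv (a i) y *: a j.
have bW i : i \in s -> b i \in W by move=> /asW aiW; rewrite memvD ?memvZ.
have [[y' y'W y's]|[c [c0 cs cb]]] := IH b us bW.
  (* This vector is orthogonal to [a j], and its product with [a i] is [dotv (b i) y']. *)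
  left; apply: (finish (- dotv (a j) y *: y' + dotv (a j) y' *: y)).
  - by rewrite memvD ?memvZ.
  - move=> i /y's; rewrite dotvDl !dotvZl dotvDr !dotvZr; lra.
  - by rewrite dotvDr !dotvZr; lra.
(* Expanding [b i] in the relation yields these weights; the guard [i \in s] gives access to the
   sign of [dotv (a i) y]. *)
right; apply: (extend (\sum_(i <- s) (if i \in s then c i * dotv (a i) y else 0))
  (fun i => - dotv (a j) y * c i)).
- by apply: sumr_ge0 => i _; case: ifP => // /ys /ltW; exact: mulr_ge0.
- by move=> i; rewrite mulr_ge0 // oppr_ge0 ltW.
- rewrite ltr_wpDl //.
    by apply: sumr_ge0 => i _; case: ifP => // /ys /ltW; exact: mulr_ge0.
  by rewrite -mulr_sumr mulr_gt0 // oppr_gt0.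
rewrite -[RHS]cb scaler_suml -big_split; apply: eq_big_seq => i i_s /=.
by rewrite i_s scalerDr !scalerA addrC [c i * - _]mulrC.
Qed.

End Gordan.

(** * Lower bounds for the restricted width *)

Section RestrictedWidth.
Context {R : realType} {m p : nat}.
Implicit Types (M : 'M[R]_(m, p)) (u v x : 'cV[R]_p) (z : 'cV[R]_m).

Lemma mulmx_col_sum M x : M *m x = \sum_i x i 0 *: col i M.
Proof.
apply/matrixP => i j; rewrite ord1 mxE summxE.
by apply: eq_bigr => k _; rewrite !mxE mulrC.
Qed.

Lemma dotv_mulmx M x z : dotv (M *m x) z = \sum_i x i 0 * dotv (col i M) z.
Proof.
rewrite mulmx_col_sum; elim/big_rec2: _ => [|i a b _ IH]; first exact: dot0v.
by rewrite dotvDl dotvZl IH.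
Qed.

Lemma maxcolnorm_ge0 M : 0 <= maxcolnorm M.
Proof. exact: bigmax_ge_id. Qed.

Lemma dotv_col_le M i z : `|dotv (col i M) z| <= maxcolnorm M * enorm z.
Proof.
apply: le_trans (cauchy_schwarz _ _) _.
by rewrite ler_wpM2r ?enorm_ge0 // (le_bigmax _ (fun i => enorm (col i M))).
Qed.

Lemma dotv_mulmx_le M x z : nonneg x ->
  `|dotv (M *m x) z| <= (\sum_i x i 0) * (maxcolnorm M * enorm z).
Proof.
move=> x0; rewrite dotv_mulmx mulr_suml; apply: le_trans (ler_norm_sum _ _ _) _.
by apply: ler_sum => i _; rewrite normrM ger0_norm // ler_wpM2l // dotv_col_le.
Qed.

Lemma simplexP x : nonneg x -> \sum_i x i 0 = 1 -> simplex x.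
Proof. by move=> x0 x1; split=> //; rewrite -x1; apply: eq_bigr => i _; rewrite ger0_norm. Qed.

Lemma simplex_sum x : simplex x -> \sum_i x i 0 = 1.
Proof. by case=> x0 x1; rewrite -x1; apply: eq_bigr => i _; rewrite ger0_norm. Qed.

Lemma phi_at_ge0 M x : 0 <= phi_at M x.
Proof.
rewrite /phi_at; set S := (X in sup X).
have [hS|/sup_out ->//] := pselect (has_sup S).
have [l Sl] := hS.1; apply: (@le_trans _ _ l); first by case: Sl => /ltW.
exact: (ub_le_sup hS.2).
Qed.

Lemma phi_at_ge M x u v s : M *m x != 0 -> simplex u -> simplex v ->
  supp u \subset supp x -> 0 < s -> M *m u - M *m v = s *: (M *m x) ->
  s * enorm (M *m x) <= phi_at M x.
Proof.
move=> Mx0 su sv uv s0 Muv; have Mx := enorm_gt0 _ Mx0.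
apply: ub_le_sup; last first.
  split; first by rewrite mulr_gt0.
  by exists u, v; split => //; rewrite mulfK ?gt_eqF.
(* An upper bound is needed for [sup] to be meaningful: pairing the equation for [l] with [M *m x]
   bounds [l * enorm (M *m x)]. *)
exists (2 * maxcolnorm M) => l [_ [u' [v' [su' sv' _ e]]]].
have := dotv_mulmx_le M _ (M *m x) su'.1.
have := dotv_mulmx_le M _ (M *m x) sv'.1.
rewrite !simplex_sum // !mul1r !ler_norml => /andP[hv _] /andP[_ hu].
have : dotv (M *m u') (M *m x) - dotv (M *m v') (M *m x) = l * enorm (M *m x).
  by rewrite -dotvBl e dotvZl -enorm_sq expr2 mulrA divfK ?gt_eqF.
by move=> e'; rewrite -(ler_pM2r Mx); lra.
Qed.

Lemma exists_col_neq0 M : M != 0 -> exists i, col i M != 0.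
Proof.
move=> M0; apply/existsP; apply: contraNT M0; rewrite negb_exists => /forallP h0.
apply/eqP/matrixP => k j; have := h0 j; rewrite negbK => /eqP /matrixP /(_ k 0).
by rewrite !mxE.
Qed.

Lemma phi_ge M l : M != 0 ->
  (forall x, nonneg x -> M *m x != 0 -> l <= phi_at M x) -> l <= phi M.
Proof.
move=> M0 h; apply: lb_le_inf; last by move=> _ [x [x0 Mx]] <-; exact: h.
have [i Mi] := exists_col_neq0 _ M0.
(* A nonzero column keeps the set nonempty, so that [inf] is not a default value. *)
exists (phi_at M (delta_mx i 0)), (delta_mx i 0) => //; split.
  by move=> j; rewrite mxE; case: (_ && _).
by rewrite -colE.
Qed.

(** Coordinates off [J] are zeroed rather than removed, so the same matrix acts on every part of
    [x]. *)
Definition restrict (J : {set 'I_p}) x : 'cV[R]_p :=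
  \col_i (if i \in J then x i 0 else 0).

Lemma restrict_nonneg J x : nonneg x -> nonneg (restrict J x).
Proof. by move=> x0 i; rewrite mxE; case: ifP. Qed.

Lemma restrict_split J x : x = restrict J x + restrict (~: J)%SET x.
Proof.
apply/matrixP => i k; rewrite ord1 !mxE inE.
by case: ifP; rewrite /= ?addr0 ?add0r.
Qed.

Lemma nonneg_sum_eq0 x : nonneg x -> \sum_i x i 0 = 0 -> x = 0.
Proof.
move=> x0 s0; apply/matrixP => i j; rewrite ord1 mxE.
exact: (psumr_eq0P _ s0).
Qed.

Lemma nonneg_sum_gt0 x : nonneg x -> x != 0 -> 0 < \sum_i x i 0.
Proof.
move=> x0 xn0; rewrite lt_def sumr_ge0 // andbT.
by apply: contraNneq xn0 => /(nonneg_sum_eq0 _ x0) ->.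
Qed.

Lemma dotv_restrict_ge M (J : {set 'I_p}) x z l : nonneg x ->
  (forall i, i \in J -> l <= dotv (col i M) z) ->
  (\sum_i restrict J x i 0) * l <= dotv (M *m restrict J x) z.
Proof.
move=> x0 h; rewrite dotv_mulmx mulr_suml; apply: ler_sum => i _; rewrite mxE.
by case: ifP => [iJ|_]; rewrite ?mul0r // ler_wpM2l // h.
Qed.

(* With a zero column available, [v] can be taken to be its vertex of the
   simplex, and then [M u] is parallel to [M x]. *)
Lemma phi_ge_zero_column M (J : {set 'I_p}) (k : 'I_p) z l : M != 0 ->
  k \notin J -> (forall i, i \notin J -> col i M = 0) -> enorm z = 1 ->
  (forall i, i \in J -> l <= dotv (col i M) z) -> l <= phi M.
Proof.
move=> M0 kJ MJ z1 hl; apply: phi_ge => // x x0 Mx.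
have Mres : M *m restrict J x = M *m x.
  rewrite !mulmx_col_sum; apply: eq_bigr => i _; rewrite mxE.
  by case: ifPn => // /MJ ->; rewrite !scaler0.
set y := restrict J x in Mres.
have y0 : nonneg y := restrict_nonneg J _ x0.
have S0 : 0 < \sum_i y i 0.
  apply: nonneg_sum_gt0 => //; apply: contraNneq Mx => y_0.
  by rewrite -Mres y_0 mulmx0.
set S := \sum_i _ in S0.
(* The middle term is the [lambda] obtained from [u = S^-1 *: y]; pairing [M *m y] with [z] bounds
   it below. *)
apply: (@le_trans _ _ (S^-1 * enorm (M *m x))).
  rewrite ler_pdivlMl //; apply: le_trans (dotv_restrict_ge _ _ _ _ _ x0 hl) _.
  by rewrite Mres; apply: le_trans (dotv_le _ _) _; rewrite z1 mulr1.
apply: (@phi_at_ge _ _ (S^-1 *: y) (delta_mx k 0)) => //.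
- apply: simplexP => [i|]; first by rewrite mxE mulr_ge0 // invr_ge0 ltW.
  under eq_bigr do rewrite mxE.
  by rewrite -mulr_sumr mulVf // gt_eqF.
- apply: simplexP => [i|]; first by rewrite mxE; case: (_ && _).
  rewrite (bigD1 k) //= mxE !eqxx big1 ?addr0 // => i ik.
  by rewrite mxE (negbTE ik).
- apply/fintype.subsetP => i; rewrite !inE !mxE pmulr_rgt0 ?invr_gt0 //.
  by case: ifP; rewrite ?ltxx.
- by rewrite invr_gt0.
- by rewrite -colE MJ // subr0 -scalemxAr Mres.
Qed.

End RestrictedWidth.

(** * Max-min values and convex hulls of columns *)

Section Conditions.
Context {R : realType} {m n : nat} (A : 'M[R]_(m, n)).
Implicit Types (J : {set 'I_n}) (V : set 'cV[R]_m).

Lemma inf_col_le J z i : i \in J ->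
  inf [set dotv (col i A) z | i in [set i | i \in J]]%classic <= dotv (col i A) z.
Proof.
move=> iJ; apply: ge_inf; last by exists i.
exists (- (maxcolnorm A * enorm z)) => _ [j _ <-].
by have := dotv_col_le A j z; rewrite ler_norml => /andP[].
Qed.

Lemma col_le_inf J z : J != finset.set0 -> exists2 i, i \in J &
  dotv (col i A) z <= inf [set dotv (col i A) z | i in [set i | i \in J]]%classic.
Proof.
case/set0Pn => i0 i0J.
have [i iJ imin] := arg_minP (fun i => dotv (col i A) z) i0J.
exists i => //; apply: lb_le_inf; first by exists (dotv (col i0 A) z), i0.
by move=> _ [j jJ <-]; exact: imin.
Qed.

(** The maximum is encoded as a supremum, so only values strictly below it are reached. The
    condition [0 <= l] excludes an empty unit sphere, where [sup] is 0. *)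
Lemma maxmin_witness V J l : 0 <= l -> l < maxmin A V J ->
  exists z, [/\ V z, enorm z = 1 & forall i, i \in J -> l <= dotv (col i A) z].
Proof.
move=> l0; rewrite /maxmin; set S := (X in sup X) => lS.
have Sn0 : (S !=set0)%classic.
  by apply/set0P; apply: contraTneq lS => ->; rewrite sup0 -leNgt.
have [_ [z [Vz z1] <-] lz] := sup_gt Sn0 lS.
exists z; split => // i iJ; apply: le_trans (ltW lz) _; exact: inf_col_le.
Qed.

Lemma maxmin_ge V J z : J != finset.set0 -> V z -> enorm z = 1 ->
  exists2 i, i \in J & dotv (col i A) z <= maxmin A V J.
Proof.
move=> J0 Vz z1; have [i iJ hi] := col_le_inf J z J0.
exists i => //; apply: le_trans hi _; apply: ub_le_sup; last by exists z.
have [j jJ] := set0Pn _ J0.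
exists (maxcolnorm A) => _ [y [_ y1] <-]; apply: le_trans (inf_col_le J y j jJ) _.
by rewrite -[leRHS]mulr1 -y1; apply: le_trans (ler_norm _) (dotv_col_le _ _ _).
Qed.

(** Pairing the positive relation with [z] gives a vanishing sum, so the products with the columns
    of [J] cannot all be positive. *)
Lemma maxmin_le0 V J : J != finset.set0 ->
  (exists xJ : 'cV[R]_#|J|, colsubset A J *m xJ = 0 /\ positive xJ) ->
  maxmin A V J <= 0.
Proof.
move=> J0 [x [Ax x0]]; rewrite leNgt; apply/negP => h.
have [l0 lV] := midf_lt h.
have [z [Vz z1 hz]] := maxmin_witness V J _ (ltW l0) lV.
have := dotv_mulmx (colsubset A J) x z; rewrite Ax dot0v => /esym/eqP.
rewrite gt_eqF //; have [j jJ] := set0Pn _ J0.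
have pos k : 0 < x k 0 * dotv (col k (colsubset A J)) z.
  rewrite mulr_gt0 //; apply: lt_le_trans l0 _.
  have -> : col k (colsubset A J) = col (enum_val k) A.
    by apply/matrixP => ? ?; rewrite !mxE.
  by apply: hz; exact: enum_valP.
rewrite (bigD1 (enum_rank_in jJ j)) //= ltr_pwDl // sumr_ge0 // => k _.
exact: ltW.
Qed.

Lemma col_colspan J i : i \in J -> col i A \in colspan A J.
Proof. by move=> iJ; apply: memv_span; apply/fintype.imageP; exists i. Qed.

Lemma mulmx_restrict_colspan J x : A *m restrict J x \in colspan A J.
Proof.
rewrite mulmx_col_sum memv_suml // => i _; rewrite mxE.
by case: ifP => [/col_colspan/memvZ //|_]; rewrite scale0r mem0v.
Qed.

(* Separating [w] from the hull by a direction of [colspan A J], which is where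
   the hypothesis applies. *)
Lemma ball_subset_hull J r w : w \in colspan A J -> enorm w <= r ->
  J != finset.set0 ->
  (forall z, z \in colspan A J -> enorm z = 1 ->
     exists2 i, i \in J & dotv (col i A) z <= - r) ->
  exists2 v, simplex v & A *m v = w.
Proof.
move=> wL wr J0 hr.
have [||[y yL hy]|[c [c0 cs ca]]] :=
    gordan (colspan A J) (enum J) (fun i => col i A - w).
- exact: enum_uniq.
- by move=> i; rewrite mem_enum => /col_colspan iL; rewrite memvB.
(* A separating [y] is impossible: for some [i] in [J], the product of [col i A] with [y] is at most
   [- r * enorm y], hence at most [dotv w y]. *)
- have [j jJ] := set0Pn _ J0.
  have yn0 : y != 0.
    have := hy j; rewrite mem_enum => /(_ jJ).
    by apply: contraTneq => ->; rewrite dotvC dot0v ltxx.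
  have [i iJ] := hr _ (memvZ (enorm y)^-1 yL) (enorm_normalize _ yn0).
  rewrite dotvZr ler_pdivrMl ?enorm_gt0 // => h.
  have := hy i; rewrite mem_enum dotvBl => /(_ iJ) => h1.
  have := cauchy_schwarz w y; rewrite ler_norml => /andP[h2 _].
  have := ler_wpM2r (enorm_ge0 y) wr; move: h1 h h2; lra.
rewrite big_enum in cs; rewrite big_enum /= in ca.
set T := (X in 0 < X) in cs.
exists (restrict J (\col_i (T^-1 * c i))).
  apply: simplexP.
    by apply: restrict_nonneg => i; rewrite mxE mulr_ge0 // invr_ge0 ltW.
  rewrite -[RHS](@mulVf _ T) ?gt_eqF // mulr_sumr [RHS]big_mkcond.
  by apply: eq_bigr => i _; rewrite !mxE.
have -> : A *m restrict J (\col_i (T^-1 * c i)) =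
    T^-1 *: \sum_(i in J) c i *: col i A.
  rewrite mulmx_col_sum scaler_sumr [RHS]big_mkcond.
  by apply: eq_bigr => i _; rewrite !mxE; case: ifP; rewrite ?scale0r ?scalerA.
have -> : \sum_(i in J) c i *: col i A = T *: w.
  apply/eqP; rewrite -subr_eq0; apply/eqP; rewrite -{}[RHS]ca /T scaler_suml.
  rewrite -sumrN -big_split.
  by apply: eq_bigr => i _; rewrite scalerBr.
by rewrite scalerA mulVf ?gt_eqF // scale1r.
Qed.

(** The alternatives reflect whether [- sigma^-1 *: g] lies in the ball of radius [r]; if not, the
    multiple of [g] of norm [r] is used instead. *)
Lemma phi_at_ge_split J r x : nonneg x -> A *m x != 0 -> 0 <= r ->
  (forall w, w \in colspan A J -> enorm w <= r ->
     exists2 v, simplex v & A *m v = w) ->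
  let sigma := \sum_i restrict (~: J)%SET x i 0 in
  let g := A *m restrict J x in
  (0 < sigma /\ enorm (A *m x) / sigma <= phi_at A x) \/
  (g != 0 /\ r * enorm (A *m x) / enorm g <= phi_at A x).
Proof.
move=> x0 Ax r0 hr sigma g.
set xN := restrict (~: J)%SET x; set xB := restrict J x.
have xE : x = xB + xN := restrict_split J x.
have N0 : nonneg xN := restrict_nonneg _ _ x0.
have B0 : nonneg xB := restrict_nonneg _ _ x0.
have sigma0 : 0 <= sigma by apply: sumr_ge0.
have gL : g \in colspan A J := mulmx_restrict_colspan J x.
have sub (s t : R) : 0 <= s -> 0 <= t -> nonneg (s *: xN + t *: xB) /\
    supp (s *: xN + t *: xB) \subset supp x.
  move=> s0 t0; split=> [i|].
    have := B0 i; have := N0 i; rewrite !mxE => n0 b0.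
    by rewrite addr_ge0 // mulr_ge0.
  apply/fintype.subsetP => i; rewrite !inE !mxE !inE => ui; rewrite lt_def x0 andbT.
  by apply: contraTneq ui => ->; rewrite !if_same !mulr0 addr0 ltxx.
have sumE (s t : R) : \sum_i (s *: xN + t *: xB) i 0 =
    s * sigma + t * \sum_i xB i 0.
  rewrite /sigma !mulr_sumr -big_split.
  by apply: eq_bigr => i _; rewrite !mxE.
have [/andP[s0 gr]|hcase] := boolP ((0 < sigma) && (enorm g <= r * sigma)).
  left; split => //.
  have [|v sv Av] := hr (- sigma^-1 *: g) (memvZ _ gL).
    by rewrite enormZ normrN ger0_norm ?invr_ge0 // ler_pdivrMl // mulrC.
  have i0 : 0 < sigma^-1 by rewrite invr_gt0.
  have [u0 us] := sub _ _ (ltW i0) (lexx 0).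
  rewrite mulrC; apply: (@phi_at_ge _ _ _ _ _ (sigma^-1 *: xN + 0 *: xB) v) => //.
    by apply: simplexP => //; rewrite sumE mulVf ?gt_eqF // mul0r addr0.
  rewrite Av scale0r addr0 xE mulmxDr -scalemxAr scaleNr opprK scalerDr.
  by rewrite addrC.
(* If [sigma] is 0, then [A *m x] equals [g]; otherwise [enorm g] exceeds [r * sigma]. *)
have [gn0 grs] : g != 0 /\ r * sigma <= enorm g.
  move: hcase; rewrite lt_def sigma0 andbT; have [s_0 _|sn0] := eqVneq sigma 0.
    split; last by rewrite s_0 mulr0 enorm_ge0.
    apply: contraNneq Ax => g_0.
    by rewrite xE mulmxDr (nonneg_sum_eq0 _ N0 s_0) mulmx0 addr0 -/g g_0.
  rewrite /= -ltNge => h; split; last exact: ltW.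
  apply: contraTneq h => ->; rewrite -leNgt (_ : enorm 0 = 0).
    exact: mulr_ge0.
  by rewrite /enorm dot0v sqrtr0.
right; split => //.
have g0 := enorm_gt0 _ gn0.
pose d := r / enorm g; have d0 : 0 <= d by rewrite divr_ge0 // enorm_ge0.
pose T := \sum_i x i 0.
have TE : T = \sum_i xB i 0 + sigma.
  rewrite /T /sigma -big_split; apply: eq_bigr => i _.
  by rewrite {1}xE mxE.
have T0 : 0 < T.
  by apply: nonneg_sum_gt0 => //; apply: contraNneq Ax => ->; rewrite mulmx0.
(* Chosen so that [(t + d) *: xN + t *: xB] has total mass [t * T + d * sigma = 1]. *)
pose t := (1 - d * sigma) / T.
have ds1 : d * sigma <= 1 by rewrite /d mulrAC ler_pdivrMr // mul1r.
have t0 : 0 <= t by rewrite divr_ge0 ?subr_ge0 // ltW.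
(* The radius [r] may be 0; then [d] is 0 and [t] is the inverse of [T]. *)
have s0 : 0 < t + d.
  rewrite lt_def addr_ge0 // andbT paddr_eq0 //; apply/negP => /andP[/eqP t_0 /eqP d_0].
  move: t_0; rewrite /t d_0 mul0r subr0 => /eqP.
  by rewrite mul1r invr_eq0 gt_eqF.
have [|v sv Av] := hr (- d *: g) (memvZ _ gL).
  by rewrite enormZ normrN ger0_norm // divfK // gt_eqF.
have [u0 us] := sub (t + d) t (ltW s0) t0.
apply: (@le_trans _ _ ((t + d) * enorm (A *m x))).
  by rewrite mulrAC -/d ler_wpM2r ?enorm_ge0 // lerDr.
apply: (@phi_at_ge _ _ _ _ _ ((t + d) *: xN + t *: xB) v) => //.
  apply: simplexP => //; rewrite sumE mulrDl addrAC -mulrDr [sigma + _]addrC -TE.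
  by rewrite divfK ?gt_eqF // subrK.
rewrite Av xE !mulmxDr -!scalemxAr -/g scaleNr opprK scalerDr -addrA -scalerDl.
by rewrite addrC.
Qed.

End Conditions.

(** * Limit argument, angle estimate and the four cases *)

Lemma le_of_lt_pos {R : realType} (a b : R) : 0 <= b ->
  (forall c, 0 < c -> c < a -> c <= b) -> a <= b.
Proof.
move=> b0 h; rewrite leNgt; apply/negP => /midf_lt[l1 l2].
by have := h _ (le_lt_trans b0 l1) l2; rewrite leNgt l1.
Qed.

(** Pairing [h + g] with a vector [y] orthogonal to [h] leaves [enorm g ^+ 2]; it remains to bound
    [enorm y] by a multiple of [enorm g]. *)
Lemma angle_bound {R : realType} {m : nat} (h g z : 'cV[R]_m) (K l sigma : R) :
  0 < l -> 0 <= K -> 0 < sigma -> enorm z = 1 -> dotv g z = 0 ->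
  sigma * l <= dotv h z -> `|dotv h g| <= sigma * (K * enorm g) ->
  l * enorm g <= Num.sqrt (K ^+ 2 + l ^+ 2) * enorm (h + g).
Proof.
move=> l0 K0 s0 z1 gz hz hg.
have [->|gn0] := eqVneq g 0.
  by rewrite {1}/enorm dot0v sqrtr0 mulr0 mulr_ge0 ?sqrtr_ge0.
have g0 := enorm_gt0 _ gn0.
have e0 : 0 < dotv h z by apply: lt_le_trans hz; rewrite mulr_gt0.
set e := dotv h z in hz e0.
(* The multiple of [z] makes [y] orthogonal to [h]. *)
pose y := g - (dotv h g / e) *: z.
have hy : dotv (h + g) y = enorm g ^+ 2.
  rewrite /y -scaleNr dotvDr dotvZr !dotvDl gz -/e addr0 -enorm_sq.
  by rewrite mulNr divfK ?gt_eqF // addrAC subrr add0r.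
have yy : (l * enorm y) ^+ 2 <= (K ^+ 2 + l ^+ 2) * enorm g ^+ 2.
  (* The mass [sigma] cancels: it scales both the lower bound on [e] and the upper bound on
     [dotv h g]. *)
  have q : l * `|dotv h g / e| <= K * enorm g.
    rewrite normrM normfV (ger0_norm (ltW e0)) mulrA ler_pdivrMr //.
    apply: le_trans (ler_wpM2l (ltW l0) hg) _.
    have -> : l * (sigma * (K * enorm g)) = K * enorm g * (sigma * l) by ring.
    by rewrite ler_wpM2l // mulr_ge0 // ltW.
  have -> : (l * enorm y) ^+ 2 = (l * `|dotv h g / e|) ^+ 2 + l ^+ 2 * enorm g ^+ 2.
    rewrite exprMn (enorm_sq y) /y -scaleNr !(dotvDl, dotvDr, dotvZl, dotvZr).
    rewrite (dotvC z g) gz -[dotv z z]enorm_sq z1 -enorm_sq exprMn.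
    by rewrite real_normK ?num_real //; ring.
  by rewrite [leRHS]mulrDl lerD2r -exprMn ler_pXn2r ?nnegrE ?mulr_ge0 // ltW.
have ly : l * enorm y <= Num.sqrt (K ^+ 2 + l ^+ 2) * enorm g.
  rewrite -(@ler_pXn2r _ 2) ?nnegrE ?mulr_ge0 ?sqrtr_ge0 ?enorm_ge0 ?(ltW l0) //.
  by rewrite [leRHS]exprMn sqr_sqrtr // addr_ge0 ?sqr_ge0.
have := dotv_le (h + g) y; rewrite hy => hgy.
rewrite -(ler_pM2r g0) -mulrA -expr2.
apply: le_trans (ler_wpM2l (ltW l0) hgy) _.
rewrite mulrCA [leRHS]mulrAC [leRHS]mulrC.
by rewrite ler_wpM2l ?enorm_ge0.
Qed.

Theorem theorem3 (R : realType) (m n : nat) (A : 'M[R]_(m, n))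
    (B N : {set 'I_n}) (A_neq0 : A != 0) (BN : canonical_partition A B N) :
  [/\ (N = finset.set0 -> colspan A B <> 0%VS /\ phi A >= `|rhoB A B|),
      (B = finset.set0 -> phi (row_mx A (0 : 'cV[R]_m)) >= rhoN A B N),
      (B <> finset.set0 -> colspan A B = 0%VS -> phi A >= rhoN A B N) &
      (N <> finset.set0 -> colspan A B <> 0%VS ->
         phi A >= `|rhoB A B| * rhoN A B N
                  / Num.sqrt (maxcolnorm A ^+ 2 + rhoN A B N ^+ 2))].
Proof.
case: BN => BN disjBN AB _.
have NE : N = (~: B)%SET.
  apply/setP => i; rewrite inE; have := finset.in_setT i; rewrite -BN inE.
  have := disjointFr disjBN (x := i); case: (i \in B) => [-> //|_ /=].
  by case: (i \in N).
have phi_pos q (M : 'M[R]_(m, q)) : M != 0 -> 0 <= phi M.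
  by move=> M0; apply: phi_ge => // x _ _; exact: phi_at_ge0.
have col0 i : i \in B -> colspan A B = 0%VS -> col i A = 0.
  by move=> /(col_colspan A) + L0; rewrite L0 memv0 => /eqP.
have Bn0 : colspan A B <> 0%VS -> B != finset.set0.
  move=> L; apply/eqP => B0; apply: L.
  apply/eqP; rewrite -subv0; apply/span_subvP => v /fintype.imageP[i].
  by rewrite B0 inE.
(* The positive relation among the columns of [B] makes [rhoB A B] nonpositive, so its absolute
   value is its opposite. *)
have rB (L : colspan A B <> 0%VS) z : z \in colspan A B -> enorm z = 1 ->
    exists2 i, i \in B & dotv (col i A) z <= - `|rhoB A B|.
  move=> zL z1; have B0 := Bn0 L.
  rewrite ler0_norm ?opprK; last exact: maxmin_le0.
  exact: maxmin_ge.
have ball (L : colspan A B <> 0%VS) w : w \in colspan A B ->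
    enorm w <= `|rhoB A B| -> exists2 v, simplex v & A *m v = w.
  by move=> wL wr; apply: ball_subset_hull wL wr (Bn0 L) (rB L).
split.
- move=> N0; have BT : (~: B)%SET = finset.set0 by rewrite -NE.
  have inB i : i \in B by have := finset.in_set0 i; rewrite -BT inE => /negbFE.
  have L : colspan A B <> 0%VS.
    by move=> L; have [i /negP[]] := exists_col_neq0 _ A_neq0; rewrite col0.
  split => //; apply: phi_ge => // x x0 Ax.
  (* With [N] empty, [sigma] is 0; the other alternative has [g = A *m x], and the quotient of norms
     is 1. *)
  have [[]|[gn0]] := phi_at_ge_split A B _ _ x0 Ax (normr_ge0 _) (ball L).
    by rewrite big1 ?ltxx // => i _; rewrite BT !mxE inE.
  have -> : restrict B x = x.
    by apply/matrixP => i j; rewrite ord1 mxE inB.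
  by rewrite mulfK // gt_eqF // enorm_gt0.
- move=> B0; have inN i : i \in N by rewrite NE B0 !inE.
  have M0 : row_mx A (0 : 'cV[R]_m) != 0.
    by apply: contraNneq A_neq0; rewrite -row_mx0 => /eq_row_mx[->].
  apply: le_of_lt_pos => [|c c0 cr]; first exact: phi_pos.
  have [z [_ z1 hz]] := maxmin_witness A _ _ _ (ltW c0) cr.
  pose k : 'I_(n + 1) := rshift n 0.
  apply: (phi_ge_zero_column _ [set~ k]%SET k z) => //.
  + by rewrite !inE eqxx.
  + move=> i; rewrite !inE negbK => /eqP ->.
    by rewrite colKr; apply/matrixP => a b; rewrite !mxE.
  + move=> i; rewrite !inE; case: (split_ordP i) => j ->; last by rewrite ord1 eqxx.
    by move=> _; rewrite colKl; exact: hz.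
- move=> /eqP/set0Pn[k kB] L0.
  apply: le_of_lt_pos => [|c c0 cr]; first exact: phi_pos.
  have [z [_ z1 hz]] := maxmin_witness A _ _ _ (ltW c0) cr.
  (* As the span is trivial, every column in [B] is zero, and any [k] in [B] serves. *)
  apply: (phi_ge_zero_column _ N k z) => //; first by rewrite NE inE kB.
  by move=> i; rewrite NE inE negbK => /col0; apply.
move=> _ L; set r := `|rhoB A B|; set rho := rhoN A B N; set K := maxcolnorm A.
have K0 : 0 <= K := maxcolnorm_ge0 A.
have r0 : 0 <= r := normr_ge0 _.
have [rho0|rho0] := leP rho 0.
  apply: le_trans (phi_pos _ _ A_neq0).
  by rewrite mulr_le0_ge0 ?invr_ge0 ?sqrtr_ge0 // mulr_ge0_le0.
set D := Num.sqrt _.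
have D0 : 0 < D by rewrite sqrtr_gt0 ltr_wpDl ?sqr_ge0 // exprn_gt0.
have le_D a b : 0 <= a -> 0 <= b -> a ^+ 2 <= b -> a <= Num.sqrt b.
  by move=> a0 b0 ab; rewrite -[a]ger0_norm // -sqrtr_sqr ler_wsqrtr.
(* [D] dominates both factors: [rho <= D] settles [sigma = 0], and [r <= D] reduces the first
   alternative to the bound [rho]. *)
have rhoD : rho <= D by rewrite le_D ?(ltW rho0) ?addr_ge0 ?lerDr ?sqr_ge0.
(* For any unit vector of the span, some column has product at most [- r] with it, yet at least
   [- K]. *)
have rK : r <= K.
  have zL := memv_pick (colspan A B).
  have zn0 : vpick (colspan A B) != 0 by rewrite vpick0; apply/eqP.
  have z1 := enorm_normalize _ zn0.
  have [i iB hi] := rB L _ (memvZ _ zL) z1.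
  have := dotv_col_le A i ((enorm (vpick (colspan A B)))^-1 *: vpick (colspan A B)).
  by rewrite z1 mulr1 ler_norml => /andP[h _]; have := le_trans h hi; rewrite lerN2.
have rD : r <= D.
  apply: le_trans rK _; rewrite le_D ?addr_ge0 ?lerDl ?sqr_ge0 //.
apply: phi_ge => // x x0 Ax.
pose h := A *m restrict (~: B)%SET x; pose g := A *m restrict B x.
pose sigma := \sum_i restrict (~: B)%SET x i 0.
have N0 := restrict_nonneg (~: B)%SET _ x0.
have Axhg : A *m x = h + g by rewrite {1}(restrict_split B x) mulmxDr addrC.
have sigma0 : 0 <= sigma by apply: sumr_ge0.
have witness c : 0 < c -> c < rho -> exists z,
    [/\ enorm z = 1, dotv g z = 0 & sigma * c <= dotv h z].
  move=> c0 cr; have [z [zL z1 hz]] := maxmin_witness A _ _ _ (ltW c0) cr.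
  exists z; split => //; first by apply: zL; exact: mulmx_restrict_colspan.
  by apply: dotv_restrict_ge => // i; rewrite -NE; exact: hz.
have [[s0]|[gn0]] := phi_at_ge_split A B _ _ x0 Ax r0 (ball L); apply: le_trans.
  apply: (@le_trans _ _ rho).
    by rewrite ler_pdivrMr // mulrC ler_wpM2l // ltW.
  apply: le_of_lt_pos => [|c c0 cr]; first by rewrite divr_ge0 ?enorm_ge0.
  have [z [z1 gz hz]] := witness c c0 cr.
  rewrite ler_pdivlMr // mulrC; apply: le_trans hz _.
  by rewrite -[dotv h z]addr0 -gz -dotvDl -Axhg -[leRHS]mulr1 -z1 dotv_le.
have g0 := enorm_gt0 _ gn0.
rewrite -!mulrA ler_wpM2l // ler_pdivrMr // mulrAC.
apply: le_of_lt_pos => [|c c0 cr]; first by rewrite divr_ge0 ?mulr_ge0 ?enorm_ge0 ?ltW.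
rewrite ler_pdivlMr //.
have [s_0|sn0] := eqVneq sigma 0.
  rewrite Axhg /h (nonneg_sum_eq0 _ N0 s_0) mulmx0 add0r [leRHS]mulrC.
  by rewrite ler_pM2r // (le_trans (ltW cr)).
have s0 : 0 < sigma by rewrite lt_def sn0.
have [z [z1 gz hz]] := witness c c0 cr.
have := angle_bound h g z K c sigma c0 K0 s0 z1 gz hz (dotv_mulmx_le A _ g N0).
(* Replacing [c] by the larger [rho] under the root only weakens the bound. *)
move/le_trans; apply; rewrite -Axhg mulrC ler_wpM2l ?enorm_ge0 //.
by rewrite ler_wsqrtr // lerD2l ler_pXn2r ?nnegrE ?ltW // (lt_trans c0).
Qed.
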